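(* For all binary relations $R$ and $S$ on IMP states and all IMP commands $c$ and $c'$, $\vDash \langle R\rangle\ c,\ c'\ \langle S\rangle$ holds if and only if both of the following hold: (i) for every state $t'$, $\langle \lambda t.\,R(t,t')\rangle\ c\ \langle \lambda t.\,\mathsf{decomp}(R,c,c',S)(t,t')\rangle$; (ii) for every state $t$, $\langle \lambda s'.\,\mathsf{decomp}(R,c,c',S)(t,s')\rangle\ c'\ \langle \lambda t'.\,S(t,t')\rangle$.
   Context: IMP commands: $c ::= x := e \mid c;c \mid \mathbf{if}\ b\ \mathbf{then}\ c\ \mathbf{else}\ c \mid \mathbf{while}\ b\ \mathbf{do}\ c \mid \mathbf{skip}$ over integer arithmetic expressions $e$ and boolean expressions $b$. States map variables to integers; $(c,s)\Rightarrow t$ is the standard big-step semantics of IMP. Relations are binary relations on states. Under-approximate relational validity: $\vDash \langle R\rangle\ c,\ c'\ \langle S\rangle$ iff $\forall t\,t'.\ S(t,t') \implies \exists s\,s'.\ R(s,s')\land (c,s)\Rightarrow t\land (c',s')\Rightarrow t'$. Under-approximate Hoare validity for predicates $P,Q$ on states: $\langle P\rangle\ c\ \langle Q\rangle$ iff $\forall t.\ Q(t)\implies\exists s.\ P(s)\land (c,s)\Rightarrow t$. The relation $\mathsf{decomp}(R,c,c',S)$ is defined by $\mathsf{decomp}(R,c,c',S)(t,s') \equiv \exists s\,t'.\ R(s,s')\land (c,s)\Rightarrow t\land (c',s')\Rightarrow t'\land S(t,t')$. *)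

(* Defs.v *)
From Stdlib Require Import ZArith String Bool.

Definition vname := string.
Definition state := vname -> Z.

(** The expression grammar is the one customary for IMP (Winskel). *)
Inductive aexp : Type :=
| ANum (n : Z)
| AVar (x : vname)
| APlus (a1 a2 : aexp)
| AMinus (a1 a2 : aexp)
| AMult (a1 a2 : aexp).

Inductive bexp : Type :=
| BTrue
| BFalse
| BEq (a1 a2 : aexp)
| BLe (a1 a2 : aexp)
| BNot (b : bexp)
| BAnd (b1 b2 : bexp)
| BOr (b1 b2 : bexp).

Inductive com : Type :=
| CSkip
| CAssign (x : vname) (a : aexp)
| CSeq (c1 c2 : com)
| CIf (b : bexp) (c1 c2 : com)
| CWhile (b : bexp) (c : com).

Fixpoint aval (a : aexp) (s : state) : Z :=
  match a with
  | ANum n => n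
  | AVar x => s x
  | APlus a1 a2 => (aval a1 s + aval a2 s)%Z
  | AMinus a1 a2 => (aval a1 s - aval a2 s)%Z
  | AMult a1 a2 => (aval a1 s * aval a2 s)%Z
  end.

Fixpoint bval (b : bexp) (s : state) : bool :=
  match b with
  | BTrue => true
  | BFalse => false
  | BEq a1 a2 => Z.eqb (aval a1 s) (aval a2 s)
  | BLe a1 a2 => Z.leb (aval a1 s) (aval a2 s)
  | BNot b1 => negb (bval b1 s)
  | BAnd b1 b2 => andb (bval b1 s) (bval b2 s)
  | BOr b1 b2 => orb (bval b1 s) (bval b2 s)
  end.

Definition update (s : state) (x : vname) (v : Z) : state :=
  fun y => if String.eqb x y then v else s y.

(** [big_step c s t] is [(c, s) => t]. *)
Inductive big_step : com -> state -> state -> Prop :=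
| BS_Skip s : big_step CSkip s s
| BS_Assign x a s : big_step (CAssign x a) s (update s x (aval a s))
| BS_Seq c1 c2 s1 s2 s3 :
    big_step c1 s1 s2 -> big_step c2 s2 s3 -> big_step (CSeq c1 c2) s1 s3
| BS_IfTrue b c1 c2 s t :
    bval b s = true -> big_step c1 s t -> big_step (CIf b c1 c2) s t
| BS_IfFalse b c1 c2 s t :
    bval b s = false -> big_step c2 s t -> big_step (CIf b c1 c2) s t
| BS_WhileFalse b c s :
    bval b s = false -> big_step (CWhile b c) s s
| BS_WhileTrue b c s1 s2 s3 :
    bval b s1 = true -> big_step c s1 s2 -> big_step (CWhile b c) s2 s3 ->
    big_step (CWhile b c) s1 s3.

Definition assn := state -> Prop.
Definition rassn := state -> state -> Prop.

Definition under_rel_valid (R : rassn) (c c' : com) (S : rassn) : Prop :=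
  forall t t', S t t' ->
    exists s s', R s s' /\ big_step c s t /\ big_step c' s' t'.

Definition under_valid (P : assn) (c : com) (Q : assn) : Prop :=
  forall t, Q t -> exists s, P s /\ big_step c s t.

(** [decomp R c c' S] relates final states of [c] to initial states of [c']. *)
Definition decomp (R : rassn) (c c' : com) (S : rassn) : rassn :=
  fun t s' =>
    exists s t', R s s' /\ big_step c s t /\ big_step c' s' t' /\ S t t'.

(* Main.v *)
Require Import Defs.

Theorem theorem3 (R S : rassn) (c c' : com) :
  under_rel_valid R c c' S <->
  (forall t' : state,
     under_valid (fun t => R t t') c (fun t => decomp R c c' S t t')) /\
  (forall t : state,
     under_valid (fun s' => decomp R c c' S t s') c' (fun t' => S t t')).
Proof.
  split.
  - intros H; split.
    + intros s' t (s & t' & HR & Hc & _).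
      exists s; auto.
    + intros t t' HS.
      destruct (H t t' HS) as (s & s' & HR & Hc & Hc').
      exists s'; split; [exists s, t'|]; auto.
  - intros [Hi Hii] t t' HS.
    destruct (Hii t t' HS) as (s' & Hd & Hc').
    destruct (Hi s' t Hd) as (s & HR & Hc).
    exists s, s'; auto.
Qed.
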